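(* Let $1\le p<q<\infty$. There exists a strong embedding $\ell_p\to\ell_q$ which is also weakly sequentially continuous. In particular, the existence of a weakly sequentially continuous coarse (resp. uniform) embedding between Banach spaces is strictly weaker than the existence of an isomorphic embedding: there exist Banach spaces $X$ and $Y$ such that there is a weakly sequentially continuous coarse (resp. uniform) embedding $X\to Y$, but $X$ is not linearly isomorphic to a subspace of $Y$.
   Context: For a map $f:X\to Y$ between Banach spaces (not assumed linear) let $\omega_f(t)=\sup\{\|f(x)-f(y)\| : \|x-y\|\le t\}$ and $\rho_f(t)=\inf\{\|f(x)-f(y)\| : \|x-y\|\ge t\}$ for $t\ge 0$. The map $f$ is a coarse embedding if $\omega_f(t)<\infty$ for all $t\ge 0$ and $\lim_{t\to\infty}\rho_f(t)=\infty$; it is a uniform embedding if $\lim_{t\to 0^+}\omega_f(t)=0$ and $\rho_f(t)>0$ for all $t>0$; it is a strong embedding if it is both a coarse and a uniform embedding. It is weakly sequentially continuous if $x_n\to x$ weakly in $X$ implies $f(x_n)\to f(x)$ weakly in $Y$. *)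

(* Defs.v *)
From HB Require Import structures.
From mathcomp Require Import all_boot all_order all_algebra.
From mathcomp Require Import all_classical all_reals all_analysis.

Set Implicit Arguments.
Unset Strict Implicit.
Unset Printing Implicit Defensive.

Import Order.TTheory GRing.Theory Num.Theory.
Import numFieldNormedType.Exports.

Local Open Scope classical_set_scope.
Local Open Scope ring_scope.

(* Real sequences with finite L^p norm for the counting measure; this is a type
   of functions, not of classes modulo null sets. *)
Definition ell (R : realType) (p : R) (p1 : 1 <= p) : Type :=
  LfunType (@counting nat R) (p1 : (1 <= p%:E)%E).

Section ell_banach.
Variables (R : realType) (p : R) (p1 : 1 <= p).
Implicit Types x y : ell p1.

HB.instance Definition _ := GRing.Lmodule.on (ell p1).

Let nrm x : R := fine ('N[@counting nat R]_p%:E [EFin \o x]).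

Let p0 : 0 < p. Proof. exact: lt_le_trans p1. Qed.

Let nrmZ (a : R) x : nrm (a *: x) = `|a| * nrm x.
Proof.
rewrite /nrm [X in fine X = _](LnormZ x a) fineM//.
by rewrite fin_numElt (lt_le_trans ltNy0) ?Lnorm_ge0//; exact: Lfunction_finite.
Qed.

Let nrm_powR x : (nrm x `^ p)%:E = (\sum_(k <oo) (`|x k| `^ p)%:E)%E.
Proof.
rewrite -poweR_EFin [X in (X `^ _)%E](finite_norm_fine x).
rewrite poweR_Lnorm ?gt_eqF// ge0_integral_count//.
  by move=> k; rewrite poweR_ge0.
Qed.

Let nrm_ge0 x : 0 <= nrm x.
Proof. by rewrite fine_ge0 ?Lnorm_ge0. Qed.

Let ler_coord_nrm x k : `|x k| <= nrm x.
Proof.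
rewrite leNgt; apply/negP => lt_x.
have := @gt0_ltr_powR _ p p0 _ _ (nrm_ge0 x) (normr_ge0 (x k)) lt_x.
apply/negP; rewrite -leNgt -lee_fin nrm_powR.
apply: le_trans (nneseries_lim_ge k.+1 _); last by move=> *; rewrite lee_fin powR_ge0.
rewrite big_nat_recr//= leeDr// sume_ge0// => *; by rewrite lee_fin powR_ge0.
Qed.

Let nrm_eq0 x : nrm x = 0 -> x = 0.
Proof.
move=> x0; apply/LfuneqP => k; apply/eqP.
by rewrite -normr_le0 -x0 ler_coord_nrm.
Qed.

HB.instance Definition _ := Lmodule_isNormed.Build R (ell p1)
  (fun x y => ler_LnormD x y) nrmZ nrm_eq0.

Lemma ell_norm_powR x :
  (`|x| `^ p)%:E = (\sum_(k <oo) (`|x k| `^ p)%:E)%E.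
Proof. exact: nrm_powR. Qed.

Lemma ler_coord_ell_norm x k : `|x k| <= `|x|.
Proof. exact: ler_coord_nrm. Qed.

Let cvg_norm_powR (T : Type) (F : set_system T) (FF : Filter F) (f : T -> R) a :
  f @ F --> a -> (`|f t| `^ p) @[t --> F] --> `|a| `^ p.
Proof.
move=> fa; have [a0|a0] := eqVneq a 0.
  rewrite a0 normr0 powR0 ?gt_eqF//.
  apply/cvgrPdist_lt => e e0.
  have e'0 : 0 < e `^ p^-1 by rewrite powR_gt0.
  move/cvgrPdist_lt: fa => /(_ _ e'0); rewrite a0; apply: filterS => t.
  rewrite !sub0r !normrN (ger0_norm (powR_ge0 _ _)) => lt_ft.
  have := @gt0_ltr_powR _ p p0 _ _ (normr_ge0 _) (powR_ge0 _ _) lt_ft.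
  by rewrite -powRrM mulVf ?gt_eqF// powRr1// ltW.
have na0 : 0 < `|a| by rewrite normr_gt0.
apply: (@cvg_comp _ _ _ (fun t => `|f t|) (fun b : R => b `^ p) _ (nbhs `|a|)).
  exact: cvg_norm.
suff : {for `|a|, continuous (fun b : R => b `^ p)} by [].
apply: differentiable_continuous; apply/derivable1_diffP.
by apply: derivable_powR; rewrite in_itv/= andbT.
Qed.

Let psum_le (u : nat -> R) (e : R) : 0 <= e ->
  (forall n, \sum_(k < n) `|u k| `^ p <= e `^ p) ->
  exists y, y = u :> (nat -> R) /\ `|y| <= e.
Proof.
move=> e0 ule.
have sum_le : (\sum_(k <oo) (`|u k| `^ p)%:E <= (e `^ p)%:E)%E.
  apply: lime_le.
    by apply: is_cvg_nneseries => k _ _; rewrite lee_fin powR_ge0.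
  apply: nearW => n; rewrite big_mkord sumEFin lee_fin; exact: ule.
have fu : u \in Lfun (@counting nat R) p%:E.
  apply/andP; split; rewrite inE; first exact: measurable_funTS.
  rewrite /= /finite_norm Lnorm_counting//= poweR_lty//.
  by rewrite (le_lt_trans sum_le)// ltry.
exists (Lfun_Sub (p1 : (1 <= p%:E)%E) fu : ell p1); split => //.
rewrite leNgt; apply/negP => lt_e.
have := @gt0_ltr_powR _ p p0 _ _ e0 (normr_ge0 _) lt_e.
by apply/negP; rewrite -leNgt -lee_fin ell_norm_powR.
Qed.

Let ell_complete (F : set_system (ell p1)) :
  ProperFilter F -> cauchy F -> cvg F.
Proof.
move=> FF cF.
have cvg_coord k : cvg ((fun x : ell p1 => x k) @ F).
  apply: (@R_complete R); apply: cauchy_exP => e e0.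
  have /cauchyP/(_ e e0)[x0 Fx0] := cF.
  exists (x0 k).
  suff : F [set x | ball (x0 k) e (x k)] by [].
  apply: filterS Fx0 => x /=; rewrite -!ball_normE/= => lt_x; apply: le_lt_trans lt_x.
  exact: (ler_coord_ell_norm (x0 - x) k).
pose l k := lim ((fun x : ell p1 => x k) @ F).
have approx e : 0 < e -> exists x0 : ell p1, F (ball x0 e) /\
    exists y, y = (fun k => l k - x0 k) :> (nat -> R) /\ `|y| <= e.
  move=> e0; have /cauchyP/(_ e e0)[x0 Fx0] := cF.
  exists x0; split => //; apply: psum_le; first exact: ltW.
  move=> n /=.
  have sum_cvg : (fun x : ell p1 => \sum_(k < n) `|x k - x0 k| `^ p) @ F -->
      \sum_(k < n) `|l k - x0 k| `^ p.
    elim: n => [|n IHn].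
      by rewrite big_ord0; under eq_fun do rewrite big_ord0; exact: cvg_cst.
    rewrite big_ord_recr/=; under eq_fun do rewrite big_ord_recr/=.
    apply: cvgD => //; apply: cvg_norm_powR.
    by apply: cvgB; [exact: cvg_coord|exact: cvg_cst].
  apply: (cvgr_to_le sum_cvg).
  apply: filterS Fx0 => x; rewrite -ball_normE/= => /ltW x0x.
  rewrite -lee_fin -sumEFin.
  apply: (@le_trans _ _ ((`|x - x0| `^ p)%:E)).
    rewrite ell_norm_powR -(big_mkord xpredT (fun k => (`|x k - x0 k| `^ p)%:E)).
    by apply: nneseries_lim_ge => *; rewrite lee_fin powR_ge0.
  by rewrite lee_fin ge0_ler_powR ?nnegrE ?(ltW p0) ?(ltW e0)// distrC.
have [x1 [_ [y1 [y1E _]]]] := approx 1 ltr01.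
apply/cvg_ex; exists (y1 + x1); apply/cvgrPdist_lt => e e0.
have e20 : 0 < e / 2 by rewrite divr_gt0.
have [x2 [Fx2 [y2 [y2E y2le]]]] := approx _ e20.
have -> : y1 + x1 = y2 + x2.
  apply/LfuneqP => k; rewrite -[LHS]/(y1 k + x1 k) -[RHS]/(y2 k + x2 k).
  by rewrite y1E y2E !subrK.
apply: filterS Fx2 => x; rewrite -ball_normE/= => x2x.
rewrite -addrA (splitr e) (le_lt_trans (ler_normD _ _))//.
by rewrite ler_ltD.
Qed.

HB.instance Definition _ := Uniform_isComplete.Build (ell p1) ell_complete.

End ell_banach.

Section embeddings.
Variable R : realType.
Variables X Y : completeNormedModType R.
Implicit Type f : X -> Y.

(* The moduli are extended reals; the infimum of an empty set is +oo, which for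
   [compression] occurs only when X = 0 and t > 0. *)
Definition expansion f (t : R) : \bar R :=
  ereal_sup [set e | exists x y : X,
    `|x - y| <= t /\ e = (`|f x - f y|%:E : \bar R)].

Definition compression f (t : R) : \bar R :=
  ereal_inf [set e | exists x y : X,
    t <= `|x - y| /\ e = (`|f x - f y|%:E : \bar R)].

Definition coarse_embedding f : Prop :=
  (forall t : R, 0 <= t -> (expansion f t < +oo)%E) /\
  compression f t @[t --> +oo%R] --> +oo%E.

Definition uniform_embedding f : Prop :=
  expansion f t @[t --> (0 : R)^'+] --> 0%E /\
  (forall t : R, 0 < t -> (0 < compression f t)%E).

Definition strong_embedding f : Prop :=
  coarse_embedding f /\ uniform_embedding f.

Definition weak_cvg (V : completeNormedModType R) (u : nat -> V) (x : V) : Prop :=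
  forall phi : {linear V -> R}, continuous phi ->
    phi (u n) @[n --> \oo] --> phi x.

Definition weakly_sequentially_continuous f : Prop :=
  forall (u : nat -> X) (x : X), weak_cvg u x -> weak_cvg (f \o u) (f x).

(* T is a linear homeomorphism of X onto its range, a linear subspace of Y. *)
Definition isomorphic_embedding (T : {linear X -> Y}) : Prop :=
  continuous T /\
  exists S : Y -> X, cancel T S /\ {within range T, continuous S}.

Definition isomorphically_embeds : Prop :=
  exists T : {linear X -> Y}, isomorphic_embedding T.

End embeddings.

(* Main.v *)
From HB Require Import structures.
Require Import Defs.
From mathcomp Require Import all_boot all_order all_algebra.
From mathcomp Require Import all_classical all_reals all_analysis.
From mathcomp Require Import ring lra.

Set Implicit Arguments.
Unset Strict Implicit.
Unset Printing Implicit Defensive.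

Import Order.TTheory GRing.Theory Num.Theory.
Import numFieldNormedType.Exports.

Local Open Scope classical_set_scope.
Local Open Scope ring_scope.

(** The line with the metric [|s - t|^(p/q)] embeds into [l_q] by
    [t |-> (t, 2^(-np/q) (sin (2^n t), cos (2^n t) - 1))_n]: for [|s - t| <= 1]
    the frequency with [1/2 <= 2^n |s - t| <= 1] gives the lower bound, and the
    upper bound is a geometric sum.  Applied to every coordinate, this yields
    [f : l_p -> l_q] with [c |x - y|^p <= |f x - f y|^q <= |x - y|^q + C |x - y|^p].
    Each coordinate of [f x] is a continuous function of one coordinate of [x],
    and weakly convergent sequences are bounded, so weak sequential continuity
    follows from the fact that in [l_q], [q > 1], bounded coordinatewise
    convergent sequences converge weakly: otherwise [m] almost disjoint humps
    would have a sum of norm [O(m^(1/q))] on which a functional is at least [m d/2].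
    Finally [l_1] does not embed into [l_2], since by the parallelogram identity
    some signs give [|\sum_k e_k T u_k|^2 <= \sum_k |T u_k|^2 <= C^2 n], while
    [|\sum_k e_k u_k|_1 = n] for the unit vectors [u_k]. *)

(** * Sequences in l_p *)

Section EllBasics.
Variables (R : realType) (p : R) (p1 : 1 <= p).
Implicit Types x y : ell p1.

Let p0 : 0 < p. Proof. exact: lt_le_trans p1. Qed.

Lemma psum_le_ell_norm x n : \sum_(k < n) `|x k| `^ p <= `|x| `^ p.
Proof.
rewrite -lee_fin ell_norm_powR -sumEFin.
rewrite -(big_mkord xpredT (fun k => (`|x k| `^ p)%:E)).
by apply: nneseries_lim_ge => *; rewrite lee_fin powR_ge0.
Qed.

Lemma nneseries_le_psum (u : nat -> R) (e : R) :
  (forall k, 0 <= u k) -> (forall n, \sum_(k < n) u k <= e) ->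
  (\sum_(k <oo) (u k)%:E <= e%:E)%E.
Proof.
move=> u0 ule; apply: lime_le.
  by apply: is_cvg_nneseries => k _ _; rewrite lee_fin.
by apply: nearW => n; rewrite big_mkord sumEFin lee_fin.
Qed.

Lemma ell_norm_le_psum x (e : R) : 0 <= e ->
  (forall n, \sum_(k < n) `|x k| `^ p <= e `^ p) -> `|x| <= e.
Proof.
move=> e0 xe.
have : `|x| `^ p <= e `^ p.
  rewrite -lee_fin ell_norm_powR; exact: nneseries_le_psum.
by apply: contra_le => /(gt0_ltr_powR p0); apply; rewrite nnegrE.
Qed.

Lemma ell_of_psum (u : nat -> R) (e : R) :
  (forall n, \sum_(k < n) `|u k| `^ p <= e) ->
  exists y : ell p1, y = u :> (nat -> R).
Proof.
move=> ule.
have sum_le : (\sum_(k <oo) (`|u k| `^ p)%:E <= e%:E)%E.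
  exact: nneseries_le_psum.
have fu : u \in Lfun (@counting nat R) p%:E.
  apply/andP; split; rewrite inE; first exact: measurable_funTS.
  rewrite /= /finite_norm Lnorm_counting//= poweR_lty//.
  by rewrite (le_lt_trans sum_le)// ltry.
by exists (Lfun_Sub (p1 : (1 <= p%:E)%E) fu : ell p1).
Qed.

Lemma ellBE x y k : (x - y) k = x k - y k. Proof. by []. Qed.
Lemma ellDE x y k : (x + y) k = x k + y k. Proof. by []. Qed.
Lemma ellZE a x k : (a *: x) k = a * x k. Proof. by []. Qed.
Lemma ell0E k : (0 : ell p1) k = 0. Proof. by []. Qed.

Lemma ell_sumE n (v : nat -> ell p1) k :
  (\sum_(i < n) v i) k = \sum_(i < n) v i k.
Proof.
elim: n => [|n IHn]; first by rewrite !big_ord0.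
by rewrite !big_ord_recr/= -IHn.
Qed.

Lemma ell_basis_ex (j : nat) :
  exists y : ell p1, y = (fun k => (k == j)%:R) :> (nat -> R).
Proof.
apply: (@ell_of_psum _ 1) => n.
have -> : \sum_(k < n) `|((val k) == j)%:R : R| `^ p = \sum_(k < n | val k == j) 1.
  rewrite [RHS]big_mkcond/=; apply: eq_bigr => k _.
  by case: eqP; rewrite ?normr1 ?normr0 ?powR1 ?powR0 ?gt_eqF.
have [jn|nj] := ltnP j n.
  rewrite (bigD1 (Ordinal jn))//= big1 ?addr0// => k /andP[/eqP kj].
  by move/eqP; case; apply: val_inj.
by rewrite big1 // => k /eqP kj; move: (ltn_ord k); rewrite kj ltnNge nj.
Qed.

Definition ell_basis j : ell p1 := projT1 (cid (ell_basis_ex j)).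

Lemma ell_basisE j k : ell_basis j k = (k == j)%:R.
Proof. by rewrite /ell_basis; case: cid => y /= ->. Qed.

Lemma ell_combE (a : nat -> R) n k :
  (\sum_(i < n) a i *: ell_basis i) k = if (k < n)%N then a k else 0.
Proof.
rewrite (ell_sumE _ (fun i => a i *: ell_basis i)).
under eq_bigr do rewrite ellZE ell_basisE.
case: ifPn => [kn|].
  rewrite (bigD1 (Ordinal kn))//= eqxx mulr1 big1 ?addr0// => i ik.
  case: eqP => [ki|]; last by rewrite mulr0.
  by move: ik; rewrite -val_eqE/= ki eqxx.
rewrite -leqNgt => nk; rewrite big1// => i _.
by rewrite gtn_eqF ?mulr0// (leq_trans (ltn_ord i)).
Qed.

Lemma psum_trunc_le (a : nat -> R) n m :
  \sum_(k < m) `|if (k < n)%N then a k else 0| `^ p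
    <= \sum_(k < n) `|a k| `^ p.
Proof.
rewrite -(big_mkord xpredT (fun k => `|if (k < n)%N then a k else 0| `^ p)).
rewrite -(big_mkord xpredT (fun k => `|a k| `^ p)).
have [mn|nm] := leqP m n.
  rewrite (big_cat_nat _ mn)//= -[leLHS]addr0 lerD ?sumr_ge0//.
  by rewrite le_eqVlt; apply/orP; left; apply/eqP; apply: eq_big_nat => i /andP[_ im];
    rewrite (leq_trans im mn).
rewrite (big_cat_nat _ (ltnW nm))//= [X in _ + X]big_nat [X in _ + X]big1 ?addr0.
  by rewrite le_eqVlt; apply/orP; left; apply/eqP; apply: eq_big_nat => i /andP[_ ->].
by move=> i /andP[ni _]; rewrite ltnNge ni/= normr0 powR0// gt_eqF.
Qed.

Lemma ell_norm_comb_le (a : nat -> R) n (e : R) : 0 <= e ->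
  \sum_(k < n) `|a k| `^ p <= e `^ p ->
  `|\sum_(i < n) a i *: ell_basis i| <= e.
Proof.
move=> e0 ae; apply: ell_norm_le_psum => // m.
under eq_bigr do rewrite ell_combE.
exact: le_trans (psum_trunc_le _ _ _) ae.
Qed.

(** The partial sums increase, so if the bound failed infinitely often it would fail for every [n],
    and the whole series would be at most [|x|^p - e]. *)
Lemma psum_ell_norm_approx x (e : R) : 0 < e ->
  \forall n \near \oo, `|x| `^ p - e <= \sum_(k < n) `|x k| `^ p.
Proof.
move=> e0.
have [//|nle] := pselect (\forall n \near \oo,
  `|x| `^ p - e <= \sum_(k < n) `|x k| `^ p).
have : (\sum_(k <oo) (`|x k| `^ p)%:E <= (`|x| `^ p - e)%:E)%E.
  apply: nneseries_le_psum => [//|n].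
  rewrite leNgt; apply/negP => xn; apply: nle; exists n => // m /= nm.
  apply: (le_trans (ltW xn)).
  rewrite -(big_mkord xpredT (fun k => `|x k| `^ p)).
  rewrite -(big_mkord xpredT (fun k => `|x k| `^ p)).
  rewrite (big_cat_nat _ nm)//= lerDl sumr_ge0//.
by rewrite -ell_norm_powR lee_fin lerDl oppr_ge0 leNgt e0.
Qed.

(** The [p]-th power of the distance is a tail of the norm series: any finite piece of it, added to
    the head of length [n], is at most a partial sum of [|x|^p], and the head already exceeds
    [|x|^p - e^p]. *)
Lemma ell_comb_cvg x : \sum_(i < n) x i *: ell_basis i @[n --> \oo] --> x.
Proof.
apply/cvgrPdist_le => e e0.
have := psum_ell_norm_approx x (powR_gt0 p e0).
apply: filterS => n xn.
apply: ell_norm_le_psum => [|m]; first exact: ltW.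
under eq_bigr do rewrite ellBE ell_combE.
have le_x := psum_le_ell_norm x (maxn m n).
suff : \sum_(k < m) `|x k - (if (k < n)%N then x k else 0)| `^ p +
    \sum_(k < n) `|x k| `^ p <= \sum_(k < maxn m n) `|x k| `^ p.
  by move: xn le_x; lra.
rewrite -(big_mkord xpredT (fun k => `|x k - (if (k < n)%N then x k else 0)| `^ p)).
rewrite -(big_mkord xpredT (fun k => `|x k| `^ p)).
rewrite -(big_mkord xpredT (fun k => `|x k| `^ p)).
rewrite [leRHS](big_cat_nat _ (leq_maxr m n))//= [leLHS]addrC.
rewrite lerD2l.
have zero a b : (b <= n)%N ->
    \sum_(a <= k < b) `|x k - (if (k < n)%N then x k else 0)| `^ p = 0.
  move=> bn; rewrite big_nat big1// => k /andP[_ kb].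
  by rewrite (leq_trans kb bn) subrr normr0 powR0 ?gt_eqF.
have [mn|nm] := leqP m n.
  by rewrite zero// sumr_ge0//.
rewrite (big_cat_nat _ (ltnW nm))//= zero// add0r.
rewrite le_eqVlt; apply/orP; left; apply/eqP; apply: eq_big_nat => k /andP[nk _].
by rewrite ltnNge nk/= subr0.
Qed.

End EllBasics.

(** * Dyadic sums *)

Section Trig.
Variable R : realType.
Implicit Types (s t : R) (b : bool).

Definition trig b t : R := if b then sin t else cos t.

Lemma trig_lip b s t : `|trig b s - trig b t| <= `|s - t|.
Proof.
wlog st : s t / s < t.
  move=> H; have [|ts|->] := ltgtP s t; first exact: H.
    by rewrite distrC [leRHS]distrC H.
  by rewrite subrr normr0.
pose df (u : R) : R := if b then cos u else - sin u.
have d_trig (u : R) : is_derive u (1 : R) (trig b) (df u).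
  rewrite /df; case: (b); [exact: is_derive_sin|exact: is_derive_cos].
have c_trig : {within `[s, t], continuous (trig b)}.
  apply: continuous_subspaceT; rewrite /trig; case: (b); first exact: continuous_sin.
  exact: continuous_cos.
have [c _ E] := MVT st (fun x _ => d_trig x) c_trig.
rewrite distrC E normrM [leRHS]distrC ler_piMl// /df.
by case: (b); rewrite ?normrN ?cos_max ?sin_max.
Qed.

Lemma trig_dist2 b s t : `|trig b s - trig b t| <= 2.
Proof.
have tr1 x : `|trig b x| <= 1 by rewrite /trig; case: b; rewrite ?cos_max ?sin_max.
by rewrite (le_trans (ler_normB _ _))// -[leRHS]/(1 + 1) lerD.
Qed.

Lemma continuous_trig b : continuous (trig b).
Proof. by case: b; [exact: continuous_sin|exact: continuous_cos]. Qed.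

Definition trig_gap : R := Num.sqrt (1 - cos 2^-1).

Lemma trig_gap_gt0 : 0 < trig_gap.
Proof.
have pi2 := pi_ge2 R.
rewrite sqrtr_gt0 subr_gt0 -[ltRHS]cos0 ltr_cos ?invr_gt0 ?in_itv//=.
all: by apply/andP; split; move: pi2; lra.
Qed.

Lemma trig_distE s t :
  (trig true s - trig true t) ^+ 2 + (trig false s - trig false t) ^+ 2 =
  2 - 2 * cos (s - t).
Proof.
have := cos2Dsin2 s; have := cos2Dsin2 t; rewrite cosB /trig; nra.
Qed.

(** The squared chord [2 - 2 cos (s - t)] on the unit circle is at least [2 (1 - cos (1/2))], so one
    of its two coordinates contributes at least half of that, which is [trig_gap ^+ 2]. *)
Lemma trig_dist_ge s t : 2^-1 <= `|s - t| <= 1 ->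
  exists b, trig_gap <= `|trig b s - trig b t|.
Proof.
move=> /andP[u2 u1].
have pi2 := pi_ge2 R.
have le_cos : cos (s - t) <= cos 2^-1.
  have half_pi : 0 <= (2^-1 : R) <= pi.
    by apply/andP; split; move: pi2; lra.
  have dist_pi : 0 <= `|s - t| <= pi.
    by apply/andP; split; move: pi2 u1 u2; lra.
  by rewrite -cos_norm leNgt ltr_cos ?in_itv//= ltNge u2.
have [[b le_b]|no] := pselect (exists b, trig_gap <= `|trig b s - trig b t|).
  by exists b.
have lt_gap b : (trig b s - trig b t) ^+ 2 < 1 - cos 2^-1.
  rewrite -real_normK ?num_real// -(@sqr_sqrtr _ (1 - cos 2^-1)) ?subr_ge0 ?cos_le1//.
  rewrite ltr_pXn2r ?nnegrE ?sqrtr_ge0// ltNge.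
  by apply/negP => le_b; apply: no; exists b.
by have := trig_distE s t; have := lt_gap true; have := lt_gap false; nra.
Qed.

End Trig.

Lemma powR_gt1 (R : realType) (a r : R) : 1 < a -> 0 < r -> 1 < a `^ r.
Proof.
move=> a1 r0; rewrite -[ltLHS](_ : 1 `^ r = 1); last by rewrite powR1.
by rewrite gt0_ltr_powR// nnegrE ltW// (lt_trans _ a1).
Qed.

Section DyadicSum.
Variables (R : realType) (p q : R).
Hypotheses (p0 : 0 < p) (pq : p < q).

Let q0 : 0 < q. Proof. exact: lt_trans pq. Qed.

(** The [q]-th power of the ratio [2^(-p/q)] between the amplitudes of consecutive frequencies. *)
Definition dyadic_weight : R := 2 `^ - p.
Local Notation rho := dyadic_weight.

Lemma dyadic_weight_gt0 : 0 < rho. Proof. exact: powR_gt0. Qed.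

Lemma dyadic_weight_lt1 : rho < 1.
Proof.
by rewrite /dyadic_weight powRN invf_lt1 ?powR_gt0// powR_gt1// ltr1n.
Qed.

Lemma dyadic_weightX n : rho ^+ n = (2 ^+ n) `^ - p.
Proof.
by rewrite -powR_mulrn ?powR_ge0// /rho -powRrM mulrC powRrM powR_mulrn.
Qed.

(** Majorant for the [q]-th powers of the oscillating differences at distance [d], one term per
    frequency; the minimum joins the trivial bound 2 to the Lipschitz bound. *)
Definition dyadic_sum n (d : R) : R :=
  \sum_(i < n) rho ^+ i * (Num.min 2 (2 ^+ i * d)) `^ q.

(** Self-similarity: passing to the next frequency amounts to doubling [d]. *)
Lemma dyadic_sumS n d :
  dyadic_sum n.+1 d = (Num.min 2 d) `^ q + rho * dyadic_sum n (2 * d).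
Proof.
rewrite /dyadic_sum big_ord_recl/= expr0 mul1r expr0 mul1r mulr_sumr; congr (_ + _).
by apply: eq_bigr => i _; rewrite /bump/= add1n !exprS mulrA [2 * _ * d]mulrAC [2 * d * _]mulrC.
Qed.

Lemma dyadic_sum_bounded n d : 0 <= d -> dyadic_sum n d <= 2 `^ q / (1 - rho).
Proof.
move=> d0.
have := @geometric_le_lim R n (2 `^ q) rho (powR_ge0 _ _) dyadic_weight_gt0.
rewrite gtr0_norm ?dyadic_weight_gt0// => /(_ dyadic_weight_lt1); apply: le_trans.
rewrite /series/= big_mkord; apply: ler_sum => i _.
rewrite mulrC ler_wpM2r ?exprn_ge0 ?(ltW dyadic_weight_gt0)//.
rewrite ge0_ler_powR ?(ltW q0) ?nnegrE// ?le_min ?ler0n ?mulr_ge0 ?exprn_ge0//.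
by rewrite ge_min lexx.
Qed.

(** [beta] solves [beta * 2^(q-p) = 1 + beta], the equation that the induction step requires;
    [gamma] is chosen so that [gamma - beta * 2^q] is the uniform bound of [dyadic_sum_bounded]. *)
Let beta := (2 `^ (q - p) - 1)^-1.
Let gamma := 2 `^ q / (1 - rho) + beta * 2 `^ q.

Let beta_gt0 : 0 < beta.
Proof.
by rewrite invr_gt0 subr_gt0 powR_gt1 ?ltr1n// subr_gt0.
Qed.

(* The correction [- beta d^q] makes the induction along
   [dyadic_sumS] close: it absorbs the term [d^q] of the step. *)
Lemma dyadic_sum_le_aux n d : 0 < d <= 2 ->
  dyadic_sum n d <= gamma * d `^ p - beta * d `^ q.
Proof.
have K0 : 0 <= 2 `^ q / (1 - rho).
  by rewrite divr_ge0 ?powR_ge0// subr_ge0 (ltW dyadic_weight_lt1).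
have one_le_powR : 1 <= 2 `^ q by rewrite -[leLHS](powRr0 2) ler_powR ?ler1n// ltW.
elim: n d => [|n IHn] d /andP[d0 d2]; have [d1|d1] := leP 1 d.
(* For [1 <= d <= 2] the uniform bound suffices, since [d^p >= 1] and [d^q <= 2^q]. In the remaining
   cases [d < 1], so [2 * d] stays in the range of the induction hypothesis. *)
1,3: apply: (le_trans (dyadic_sum_bounded _ (ltW d0))).
1,2: have dp1 : 1 <= d `^ p by rewrite -[leLHS](powRr0 d) ler_powR// ltW.
1,2: have dq2 : d `^ q <= 2 `^ q by rewrite ge0_ler_powR ?nnegrE ?(ltW q0) ?(ltW d0).
1,2: rewrite lerBrDr; apply: (@le_trans _ _ gamma);
  rewrite ?ler_peMr// ?lerD2l ?ler_wpM2l// ?(ltW beta_gt0)//.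
1,2: by rewrite addr_ge0// mulr_ge0 ?powR_ge0// ltW.
  rewrite /dyadic_sum big_ord0 subr_ge0.
  have dqp : d `^ q <= d `^ p by rewrite ger_powR ?(ltW pq)// d0 ltW.
  apply: ler_pM; rewrite ?powR_ge0 ?(ltW beta_gt0)// /gamma.
  by move: beta_gt0 K0 one_le_powR; nra.
rewrite dyadic_sumS (min_idPr d2).
have d20 : 0 < 2 * d <= 2 by apply/andP; split; lra.
have := IHn _ d20; rewrite -(ler_pM2l dyadic_weight_gt0) => H.
apply: (le_trans (lerD (lexx _) H)).
rewrite mulrBr mulrCA [rho * (beta * _)]mulrCA.
have -> : rho * (2 * d) `^ p = d `^ p.
  rewrite powRM ?ltW// mulrA /rho -powRD ?addNr ?powRr0 ?mul1r//.
  by rewrite pnatr_eq0 implybT.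
have -> : rho * (2 * d) `^ q = 2 `^ (q - p) * d `^ q.
  by rewrite powRM ?ltW// mulrA /rho -powRD ?[- p + q]addrC// pnatr_eq0 implybT.
have betaE : beta * 2 `^ (q - p) = 1 + beta.
  have : 2 `^ (q - p) - 1 != 0 by rewrite -invr_eq0 gt_eqF.
  by rewrite /beta => ?; field.
by rewrite [beta * (_ * _)]mulrA betaE; lra.
Qed.

Lemma dyadic_sum_le : exists2 C, 0 <= C &
  forall n d, 0 <= d -> dyadic_sum n d <= C * d `^ p.
Proof.
have K0 : 0 <= 2 `^ q / (1 - rho).
  by rewrite divr_ge0 ?powR_ge0// subr_ge0 (ltW dyadic_weight_lt1).
exists gamma.
  by rewrite /gamma addr_ge0// mulr_ge0 ?powR_ge0 ?(ltW beta_gt0).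
move=> n d; rewrite le_eqVlt => /predU1P[<-|d0].
  rewrite powR0 ?gt_eqF// mulr0 /dyadic_sum big1// => i _.
  by rewrite mulr0 (min_idPr _)// powR0 ?mulr0 ?gt_eqF.
have [d2|d2] := leP d 2.
  apply: (le_trans (dyadic_sum_le_aux _ _)); first by rewrite d0.
  by rewrite gerDl oppr_le0 mulr_ge0 ?powR_ge0 ?(ltW beta_gt0).
apply: (le_trans (dyadic_sum_bounded _ (ltW d0))).
have dp1 : 1 <= d `^ p by rewrite -[leLHS](powRr0 d) ler_powR ?(ltW p0)//; lra.
rewrite -[leLHS]mulr1; apply: ler_pM => //.
by rewrite /gamma lerDl mulr_ge0 ?powR_ge0 ?(ltW beta_gt0).
Qed.

End DyadicSum.

(** * Snowflake of the line in l_q *)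

Section Snowflake.
Variables (R : realType) (p q : R).
Hypotheses (p0 : 0 < p) (pq : p < q).

Let q0 : 0 < q. Proof. exact: lt_trans pq. Qed.

(* The map [t |-> (snow j t)_j] embeds [(R, |s - t|^(p/q))] into [l_q]; the
   coordinate [j = 0] takes care of large distances, the oscillating ones of
   small distances. *)
Definition snow (j : nat) (t : R) : R :=
  if j is i.+1 then
    (2 ^+ i./2) `^ (- (p / q)) * (trig (odd i) (2 ^+ i./2 * t) - trig (odd i) 0)
  else t.

Lemma snow0 j : snow j 0 = 0.
Proof. by case: j => //= i; rewrite mulr0 subrr mulr0. Qed.

Lemma continuous_snow j : continuous (snow j).
Proof.
case: j => [|i] t; first exact: cvg_id.
apply: cvgM; first exact: cvg_cst.
apply: cvgB; last exact: cvg_cst.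
apply: continuous_comp; last exact: continuous_trig.
by apply: cvgM; [exact: cvg_cst|exact: cvg_id].
Qed.

Lemma snow_dist i s t : `|snow i.+1 s - snow i.+1 t| `^ q =
  dyadic_weight p ^+ i./2 *
    `|trig (odd i) (2 ^+ i./2 * s) - trig (odd i) (2 ^+ i./2 * t)| `^ q.
Proof.
rewrite /snow -mulrBr opprB addrA subrK normrM powRM// ger0_norm ?powR_ge0//.
by rewrite -powRrM mulNr divfK ?gt_eqF// -dyadic_weightX.
Qed.

Lemma snow_dist_le i s t : `|snow i.+1 s - snow i.+1 t| `^ q <=
  dyadic_weight p ^+ i./2 * (Num.min 2 (2 ^+ i./2 * `|s - t|)) `^ q.
Proof.
rewrite snow_dist ler_wpM2l ?exprn_ge0 ?(ltW (dyadic_weight_gt0 _))//.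
rewrite ge0_ler_powR ?(ltW q0) ?nnegrE ?le_min ?ler0n ?mulr_ge0 ?exprn_ge0//.
rewrite trig_dist2 (le_trans (trig_lip _ _ _))//.
by rewrite -mulrBr normrM ger0_norm ?exprn_ge0.
Qed.

Lemma snow_upper : exists2 C, 0 <= C & forall n s t,
  \sum_(j < n) `|snow j s - snow j t| `^ q <= `|s - t| `^ q + C * `|s - t| `^ p.
Proof.
have [C C0 leC] := dyadic_sum_le p0 pq.
exists (2 * C) => [|n s t]; first by rewrite mulr_ge0.
(* Each frequency occupies two consecutive coordinates, cosine then sine, whence [m.*2] terms and
   the factor 2. *)
have le_dyadic m : \sum_(i < m.*2) `|snow i.+1 s - snow i.+1 t| `^ q <=
    2 * dyadic_sum p q m `|s - t|.
  elim: m => [|m IHm]; first by rewrite /dyadic_sum !big_ord0 mulr0.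
  rewrite /dyadic_sum doubleS !big_ord_recr/= -/(dyadic_sum p q m _).
  have := snow_dist_le m.*2 s t; have := snow_dist_le m.*2.+1 s t.
  by rewrite /= uphalf_double doubleK; move: IHm; lra.
apply: (@le_trans _ _ (\sum_(j < n.*2.+1) `|snow j s - snow j t| `^ q)).
  rewrite -!(big_mkord xpredT (fun j => `|snow j s - snow j t| `^ q)).
  have nn : (n <= n.*2.+1)%N by rewrite -addnn -addnS leq_addr.
  by rewrite [leRHS](big_cat_nat _ nn)//= lerDl sumr_ge0.
rewrite big_ord_recl/= lerD2l (le_trans (le_dyadic n))// -mulrA ler_wpM2l//.
exact: leC.
Qed.

Lemma dyadic_level (d : R) : 0 < d <= 1 ->
  exists n, 2^-1 <= 2 ^+ n * d <= 1.
Proof.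
move=> /andP[d0 d1].
have ex : exists n, 1 < 2 ^+ n * d.
  exists (Num.bound d^-1); rewrite -ltr_pdivrMr// mul1r.
  apply: (lt_trans (archi_boundP _)); first by rewrite invr_ge0 ltW.
  by rewrite -natrX ltr_nat ltn_expl.
(* The least exponent that pushes [d] above 1 is positive because [d <= 1]; its predecessor is the
   required level. *)
case: (ex_minnP ex) => -[|n]; first by rewrite mul1r ltNge d1.
move=> n1 min_n; exists n; apply/andP; split.
  by move: n1; rewrite exprS -mulrA; lra.
by rewrite leNgt; apply/negP => /min_n; rewrite ltnn.
Qed.

Lemma snow_lower : exists2 c, 0 < c & forall s t, exists j,
  c * `|s - t| `^ p <= `|snow j s - snow j t| `^ q.
Proof.
exists (Num.min 1 (trig_gap R `^ q)) => [|s t].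
  by rewrite lt_min ltr01 powR_gt0// trig_gap_gt0.
have [d0|d0] := eqVneq `|s - t| 0.
  by exists 0%N; rewrite d0 powR0 ?gt_eqF// mulr0 powR_ge0.
have [d1|d1] := ltP 1 `|s - t|.
  exists 0%N => /=; apply: (@le_trans _ _ (`|s - t| `^ p)).
    by rewrite ler_piMl ?powR_ge0// ge_min lexx.
  by rewrite ler_powR ?ltW.
have dgt0 : 0 < `|s - t| by rewrite lt_neqAle eq_sym d0 normr_ge0.
have [|n /andP[n2 n1]] := @dyadic_level `|s - t|; first by rewrite dgt0.
have [|b gapb] := @trig_dist_ge R (2 ^+ n * s) (2 ^+ n * t).
  by rewrite -mulrBr normrM ger0_norm ?exprn_ge0// n2.
(* The coordinate of frequency [2^n] that carries the sine or the cosine according to [b]. *)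
exists (b + n.*2).+1.
rewrite snow_dist half_bit_double oddD odd_double addbF oddb.
rewrite [leRHS]mulrC; apply: ler_pM; rewrite ?le_min ?ler01 ?powR_ge0//.
  rewrite ge_min; apply/orP; right.
  by rewrite ge0_ler_powR ?nnegrE ?(ltW q0) ?(ltW (trig_gap_gt0 _)).
(* The weight [(2^n)^(-p)] dominates [|s - t|^p] because [2^n |s - t| <= 1]. *)
rewrite dyadic_weightX powRN -[leRHS]mul1r ler_pdivlMr ?powR_gt0 ?exprn_gt0//.
rewrite -powRM ?exprn_ge0// mulrC -[leRHS](_ : 1 `^ p = 1); last by rewrite powR1.
by rewrite ge0_ler_powR ?nnegrE ?mulr_ge0 ?exprn_ge0 ?(ltW p0).
Qed.

End Snowflake.

(** Indices that code no element contribute 0, and on the range of [pickle] the unordered sum is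
    reindexed by an injection. With [T] the pairs of naturals this flattens a double series. *)
Lemma esum_pickle_inv (R : realType) (T : countType) (h : T -> \bar R) :
  (forall t, 0 <= h t)%E ->
  (\sum_(i <oo) oapp h 0 (pickle_inv i) = \esum_(t in setT) h t)%E.
Proof.
move=> h0; have a0 (i : nat) : (0 <= oapp h 0 (@pickle_inv T i))%E by case: pickle_inv.
rewrite nneseries_esumT//.
transitivity (\esum_(i in range (@pickle T)) oapp h 0%E (pickle_inv i)).
  rewrite [RHS]esum_mkcond; apply: eq_esum => i _; case: ifPn => //.
  case E : (pickle_inv i) => [t|//]; rewrite notin_setE => -[]; exists t => //.
  by have := @pickle_invK T i; rewrite E.
rewrite esum_image; last by move=> s t _ _; exact: (pcan_inj pickleK).
by apply: eq_esum => t _; rewrite pickleK_inv.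
Qed.

Lemma esum_pickle_inv2 (R : realType) (h : nat * nat -> \bar R) :
  (forall t, 0 <= h t)%E ->
  (\sum_(i <oo) oapp h 0 (pickle_inv i) =
   \sum_(k <oo) \sum_(j <oo) h (k, j))%E.
Proof.
move=> h0; rewrite esum_pickle_inv// nneseries_esumT => [|k]; last first.
  by apply: nneseries_ge0 => j _ _.
under [RHS]eq_esum do rewrite nneseries_esumT//.
rewrite (@esum_esum _ _ _ setT (fun=> setT) (fun k j => h (k, j)))//.
by rewrite (_ : setT `*`` _ = setT) ?predeqE//; apply: eq_esum => -[].
Qed.

(** * Strong embedding of l_p into l_q *)

Lemma cvg_norm_powR0 (R : realType) (T : Type) (F : set_system T)
    (FF : Filter F) (u : T -> R) (r : R) :
  0 < r -> u @ F --> (0 : R) -> `|u t| `^ r @[t --> F] --> (0 : R).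
Proof.
move=> r0 u0; apply/cvgrPdist_lt => e e0.
have /cvgrPdist_lt/(_ _ (powR_gt0 r^-1 e0)) := u0; apply: filterS => t.
rewrite !sub0r !normrN (ger0_norm (powR_ge0 _ _)) => lt_ut.
have := @gt0_ltr_powR _ r r0 _ _ (normr_ge0 _) (powR_ge0 _ _) lt_ut.
by rewrite -powRrM mulVf ?gt_eqF// powRr1// ltW.
Qed.

(** Used with [a = p / q] for the snowflake map and with [a = 1] for linear embeddings: [c * t^a]
    bounds the compression from below and [up t] bounds the expansion from above. *)
Lemma strong_embedding_of_bounds (R : realType) (X Y : completeNormedModType R)
    (f : X -> Y) (c a : R) (up : R -> R) :
  0 < c -> 0 < a ->
  (forall x y, c * `|x - y| `^ a <= `|f x - f y|) ->
  {in Num.nneg &, {homo up : s t / s <= t}} -> up t @[t --> 0^'+] --> 0 ->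
  (forall x y, `|f x - f y| <= up `|x - y|) ->
  strong_embedding f.
Proof.
move=> c0 a0 lo up_nd up0 le_up.
have exp_le (t : R) : 0 <= t -> (expansion f t <= (up t)%:E)%E.
  move=> t0; apply: ge_ereal_sup => _ [x [y [xy ->]]].
  by rewrite lee_fin (le_trans (le_up _ _))// up_nd ?nnegrE.
have le_comp (t : R) : 0 <= t -> ((c * t `^ a)%:E <= compression f t)%E.
  move=> t0; apply: le_ereal_inf_tmp => _ [x [y [xy ->]]].
  rewrite lee_fin (le_trans _ (lo _ _))// ler_wpM2l ?(ltW c0)//.
  by rewrite ge0_ler_powR ?nnegrE ?(ltW a0).
have exp_ge0 (t : R) : 0 <= t -> (0 <= expansion f t)%E.
  by move=> t0; apply: ereal_sup_ubound; exists 0, 0; rewrite !subrr !normr0.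
split; split.
- by move=> t t0; rewrite (le_lt_trans (exp_le _ t0))// ltry.
- apply/cvgeyPge => A; exists ((`|A| / c) `^ a^-1); split; first exact: num_real.
  move=> t At; have t0 : 0 <= t by rewrite (le_trans _ (ltW At)) ?powR_ge0.
  apply: le_trans (le_comp t t0); rewrite lee_fin (le_trans (ler_norm _))//.
  rewrite mulrC -ler_pdivrMr//.
  have Ac0 : 0 <= `|A| / c by rewrite divr_ge0// ltW.
  rewrite -[leLHS]powRr1// -(mulVf (lt0r_neq0 a0)) powRrM.
  by rewrite ge0_ler_powR ?nnegrE ?powR_ge0 ?(ltW a0) ?(ltW At).
- have bnd : \forall t \near (0 : R)^'+, (0 <= expansion f t <= (up t)%:E)%E.
    near=> t; have t0 : 0 <= t by near: t; exact: nbhs_right_ge.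
    by rewrite exp_ge0 ?exp_le.
  apply: (squeeze_cvge bnd); first exact: (@cvg_cst (\bar R)).
  by apply: cvg_EFin => //; exact: nearW.
- move=> t t0; apply: lt_le_trans (le_comp t (ltW t0)).
  by rewrite lte_fin mulr_gt0// powR_gt0.
Unshelve. all: by end_near. Qed.

Section EllEmbedding.
Variables (R : realType) (p q : R) (p1 : 1 <= p) (q1 : 1 <= q).
Hypothesis pq : p < q.

Let p0 : 0 < p. Proof. exact: lt_le_trans p1. Qed.
Let q0 : 0 < q. Proof. exact: lt_le_trans q1. Qed.

(** The contractive inclusion of [l_p] in [l_q], from [|x k|^q <= |x k|^p |x|^(q-p)]. *)
Lemma psum_powR_le_norm (x : ell p1) n : \sum_(k < n) `|x k| `^ q <= `|x| `^ q.
Proof.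
have qE y : y `^ q = y `^ p * y `^ (q - p).
  by rewrite -powRD ?[p + _]addrC ?subrK// gt_eqF.
apply: (@le_trans _ _ (\sum_(k < n) `|x k| `^ p * `|x| `^ (q - p))).
  apply: ler_sum => k _; rewrite qE ler_wpM2l ?powR_ge0//.
  by rewrite ge0_ler_powR ?nnegrE ?subr_ge0 ?(ltW pq)// ler_coord_ell_norm.
by rewrite -mulr_suml qE ler_wpM2r ?powR_ge0// psum_le_ell_norm.
Qed.

(** The [l_q]-sum over [k] of the snowflakes of [x k], flattened to one index through the coding of
    pairs; an index that codes no pair carries 0. *)
Definition snow_seq (x : ell p1) (i : nat) : R :=
  oapp (fun kj : nat * nat => snow p q kj.2 (x kj.1)) 0 (pickle_inv i).

Lemma snow_seq_dist x y :
  (\sum_(i <oo) (`|snow_seq x i - snow_seq y i| `^ q)%:E =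
   \sum_(k <oo) \sum_(j <oo) (`|snow p q j (x k) - snow p q j (y k)| `^ q)%:E)%E.
Proof.
rewrite -(@esum_pickle_inv2 _ (fun kj : nat * nat =>
  (`|snow p q kj.2 (x kj.1) - snow p q kj.2 (y kj.1)| `^ q)%:E)); last first.
  by move=> t; rewrite lee_fin powR_ge0.
apply: eq_eseriesr => i _; rewrite /snow_seq; case: pickle_inv => //=.
by rewrite subrr normr0 powR0 ?gt_eqF.
Qed.

Lemma snow_seq_upper : exists2 C, 0 <= C & forall x y,
  (\sum_(i <oo) (`|snow_seq x i - snow_seq y i| `^ q)%:E
    <= (`|x - y| `^ q + C * `|x - y| `^ p)%:E)%E.
Proof.
have [C C0 leC] := snow_upper p0 pq.
exists C => // x y; rewrite snow_seq_dist.
apply: (@le_trans _ _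
  (\sum_(k <oo) (`|(x - y) k| `^ q + C * `|(x - y) k| `^ p)%:E)%E).
  apply: lee_nneseries => [k _ _|k _].
    by apply: nneseries_ge0 => j _ _; rewrite lee_fin powR_ge0.
  by apply: nneseries_le_psum => // n; exact: leC.
apply: nneseries_le_psum => [k|n].
  by rewrite addr_ge0 ?mulr_ge0 ?powR_ge0.
rewrite big_split -mulr_sumr.
by apply: lerD; [exact: psum_powR_le_norm|rewrite ler_wpM2l// psum_le_ell_norm].
Qed.

Lemma snow_seq_lower : exists2 c, 0 < c & forall x y,
  ((c * `|x - y| `^ p)%:E
    <= \sum_(i <oo) (`|snow_seq x i - snow_seq y i| `^ q)%:E)%E.
Proof.
have [c c0 lec] := @snow_lower R p q p0 pq.
exists c => // x y; rewrite snow_seq_dist EFinM ell_norm_powR -nneseriesZl//.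
apply: lee_nneseries => [k _ _|k _].
  by rewrite -EFinM lee_fin mulr_ge0 ?powR_ge0 ?(ltW c0).
have [j lej] := lec (x k) (y k).
apply: (@le_trans _ _ (`|snow p q j (x k) - snow p q j (y k)| `^ q)%:E).
  by rewrite -EFinM lee_fin.
rewrite (le_trans _ (@nneseries_lim_ge _ _ xpredT 0 j.+1 _))//.
by rewrite big_nat_recr//= leeDr// sume_ge0.
Qed.

Lemma snow_ell_ex : exists f : ell p1 -> ell q1,
  forall x, f x = snow_seq x :> (nat -> R).
Proof.
have [C C0 leC] := snow_seq_upper.
have ex x : exists y : ell q1, y = snow_seq x :> (nat -> R).
  apply: (@ell_of_psum _ _ _ _ (`|x| `^ q + C * `|x| `^ p)) => n.
  (* Summability is the upper estimate against 0, whose image is the zero sequence. *)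
  have := leC x 0; rewrite subr0 -lee_fin; apply: le_trans.
  rewrite -sumEFin -(big_mkord xpredT (fun k => (`|snow_seq x k| `^ q)%:E)).
  have E k : snow_seq x k - snow_seq 0 k = snow_seq x k.
    by rewrite /snow_seq; case: pickle_inv => [kj|]/=; rewrite ?ell0E ?snow0 ?subr0.
  under eq_bigr do rewrite -E.
  exact: nneseries_lim_ge.
by exists (fun x => projT1 (cid (ex x))) => x; case: cid.
Qed.

Definition snow_ell : ell p1 -> ell q1 := projT1 (cid snow_ell_ex).

Lemma snow_ellE x : snow_ell x = snow_seq x :> (nat -> R).
Proof. by rewrite /snow_ell; case: cid. Qed.

Lemma snow_ell_dist x y : (`|snow_ell x - snow_ell y| `^ q)%:E =
  (\sum_(i <oo) (`|snow_seq x i - snow_seq y i| `^ q)%:E)%E.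
Proof.
rewrite ell_norm_powR; apply: eq_eseriesr => i _.
by rewrite ellBE !snow_ellE.
Qed.

Lemma strong_embedding_snow_ell : strong_embedding snow_ell.
Proof.
have [C C0 leC] := snow_seq_upper; have [c c0 lec] := snow_seq_lower.
have rootK (y : R) : 0 <= y -> (y `^ q) `^ q^-1 = y.
  by move=> y0; rewrite -powRrM mulfV ?gt_eqF// powRr1.
have qV_gt0 : 0 < q^-1 by rewrite invr_gt0.
have qV0 := ltW qV_gt0.
(* Both estimates concern [q]-th powers of the distance; these are their [q]-th roots. *)
apply: (@strong_embedding_of_bounds _ _ _ _ (c `^ q^-1) (p / q)
    (fun t => (t `^ q + C * t `^ p) `^ q^-1)).
- exact: powR_gt0.
- exact: divr_gt0.
- move=> x y; have := lec x y; rewrite -snow_ell_dist lee_fin => H.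
  rewrite -[leRHS]rootK// powRrM -powRM ?powR_ge0 ?(ltW c0)//.
  by rewrite ge0_ler_powR ?nnegrE ?mulr_ge0 ?powR_ge0 ?(ltW c0).
- move=> s t; rewrite !nnegrE => s0 t0 st.
  rewrite ge0_ler_powR ?nnegrE ?addr_ge0 ?mulr_ge0 ?powR_ge0//.
  by rewrite lerD ?ler_wpM2l// ge0_ler_powR ?nnegrE// ltW.
- have u0 : t `^ q + C * t `^ p @[t --> 0^'+] --> (0 : R).
    rewrite -[X in _ --> X](addr0 0); apply: cvgD; first exact: powR_cvg0.
    by rewrite -[X in _ --> X](mulr0 C); apply: cvgMr; exact: powR_cvg0.
  have -> : (fun t : R => (t `^ q + C * t `^ p) `^ q^-1) =
      (fun t => `|t `^ q + C * t `^ p| `^ q^-1).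
    by apply/funext => t; rewrite ger0_norm// addr_ge0 ?mulr_ge0 ?powR_ge0.
  exact: cvg_norm_powR0.
- move=> x y; have := leC x y; rewrite -snow_ell_dist lee_fin => H.
  rewrite -[leLHS]rootK//.
  by rewrite ge0_ler_powR ?nnegrE ?addr_ge0 ?mulr_ge0 ?powR_ge0.
Qed.

End EllEmbedding.

(** * Weakly convergent sequences *)

Lemma continuous_linear_bound (R : realType) (X Y : normedModType R)
    (T : {linear X -> Y}) : continuous T ->
  exists2 C : R, 0 < C & forall x, `|T x| <= C * `|x|.
Proof.
move=> /linear_bounded_continuous/linear_boundedP[M [_ TM]].
exists (`|M| + 1); first by rewrite ltr_wpDl.
by apply: TM; rewrite (le_lt_trans (ler_norm _))// ltrDl.
Qed.

(** Stated for bare functions, so that functionals given by finite sums or pointwise limits are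
    packed as linear maps in one place only, [continuous_bounded_functional]. *)
Definition bounded_functional (R : realType) (X : normedModType R)
    (C : R) (phi : X -> R) : Prop :=
  (forall a x y, phi (a *: x + y) = a * phi x + phi y) /\
  (forall x, `|phi x| <= C * `|x|).

Section BoundedFunctional.
Variables (R : realType) (X : completeNormedModType R).
Implicit Types (phi psi : X -> R) (u : nat -> X).

Lemma continuous_bounded_functional C phi : bounded_functional C phi ->
  exists2 psi : {linear X -> R}, continuous psi & psi =1 phi.
Proof.
move=> [lin bnd].
have linp : linear (phi : X -> R^o) by move=> a x y; exact: lin.
pose psi : {linear X -> R} := HB.pack phi (GRing.isLinear.Build _ _ _ _ phi linp).
exists psi => //; apply/linear_bounded_continuous/linear_boundedP.
exists C; split; first exact: num_real.
by move=> r Cr x; rewrite (le_trans (bnd x))// ler_wpM2r// ltW.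
Qed.

Lemma weak_cvg_bounded_functional C phi u x :
  bounded_functional C phi -> weak_cvg u x -> phi (u n) @[n --> \oo] --> phi x.
Proof.
move=> /continuous_bounded_functional[psi cpsi psiE] /(_ psi cpsi).
by rewrite psiE; under eq_fun do rewrite psiE.
Qed.

(* A gliding hump argument: [phi = \sum_k eps_k 9^-k psi_k], where [psi_k] almost
   norms [u (n k)] and the sign [eps_k] prevents the partial sum from cancelling
   it, satisfies [|phi (u (n k))| >= 9^-k |u (n k)| / 4]. *)
Lemma weak_cvg_bounded u x :
  (forall y : X, exists2 phi, bounded_functional 2 phi & `|y| / 2 <= `|phi y|) ->
  weak_cvg u x -> exists M, forall n, `|u n| <= M.
Proof.
move=> norming ux; have [//|unb] := pselect (exists M, forall n, `|u n| <= M).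
(* The threshold is such that [9^-k |u n| / 4 >= k], which makes the final functional unbounded
   along the sequence. *)
have large (k : nat) : exists n, 4 * k%:R * 9 ^+ k <= `|u n|.
  have [//|small] := pselect (exists n, 4 * k%:R * 9 ^+ k <= `|u n|).
  case: unb; exists (4 * k%:R * 9 ^+ k) => n.
  by rewrite leNgt; apply/negP => /ltW ?; apply: small; exists n.
pose z k := u (projT1 (cid (large k))).
have z_large k : 4 * k%:R * 9 ^+ k <= `|z k| by rewrite /z; case: cid.
have norming' k : exists phi,
    bounded_functional 2 phi /\ `|z k| / 2 <= `|phi (z k)|.
  by have [phi ? ?] := norming (z k); exists phi.
pose psi k := projT1 (cid (norming' k)).
have psi_bnd k : bounded_functional 2 (psi k) by rewrite /psi; case: cid => ? [].
have psi_z k : `|z k| / 2 <= `|psi k (z k)| by rewrite /psi; case: cid => ? [].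
pose r : R := 9^-1.
pose S := fix S k : X -> R := if k is k'.+1 then
  fun y => S k' y + (if 0 <= S k' (z k) * psi k (z k) then 1 else -1) *
                    (r ^+ k * psi k y) else psi 0%N.
have S_lin k a y w : S k (a *: y + w) = a * S k y + S k w.
  elim: k => [|k IHk] /=; first by have [-> _] := psi_bnd 0%N.
  by have [-> _] := psi_bnd k.+1; rewrite IHk; ring.
have r0 k : 0 < r ^+ k by rewrite exprn_gt0// invr_gt0.
have S_z k : r ^+ k * (`|z k| / 2) <= `|S k (z k)|.
  case: k => [|k]; first by rewrite mul1r; exact: psi_z.
  apply: (@le_trans _ _ (r ^+ k.+1 * `|psi k.+1 (z k.+1)|)).
    by rewrite ler_pM2l.
  rewrite -[in leLHS](ger0_norm (ltW (r0 k.+1))) -normrM /=.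
  (* With the chosen sign the two summands do not oppose each other, so the sum is at least as large
     as the second one in absolute value. *)
  set s := S k _; set t := psi _ _; case: ifPn; rewrite -?ltNge => st.
    rewrite mul1r; have := r0 k.+1; set e := r ^+ k.+1 => e0.
    rewrite -ler_sqr ?nnegrE// !real_normK ?num_real//.
    by move: (mulr_ge0 (ltW e0) st); nra.
  have := r0 k.+1; set e := r ^+ k.+1 => e0.
  rewrite -ler_sqr ?nnegrE// !real_normK ?num_real//.
  have : 0 < e * - (s * t) by rewrite mulr_gt0// oppr_gt0.
  by nra.
(* Base 9 gives [2 * 9^-(k+1) = (9^-k - 9^-(k+1)) / 4], so the increments telescope to a total of at
   most [9^-k |y| / 4], half of the lower bound in [S_z]. *)
have S_step k y : `|S k.+1 y - S k y| <= (r ^+ k - r ^+ k.+1) * (`|y| / 4).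
  rewrite /= addrC addKr 2!normrM (ger0_norm (ltW (r0 _))).
  rewrite (_ : `|if _ then _ else _| = 1) ?mul1r; last first.
    by case: ifP; rewrite ?normrN normr1.
  have -> : (r ^+ k - r ^+ k.+1) * (`|y| / 4) = r ^+ k.+1 * (2 * `|y|).
    by rewrite exprS /r; field.
  by rewrite ler_pM2l//; exact: (psi_bnd k.+1).2.
have S_dist k m y : (k <= m)%N ->
    `|S m y - S k y| <= (r ^+ k - r ^+ m) * (`|y| / 4).
  move=> /subnK <-; elim: (m - k)%N => [|i IHi].
    by rewrite add0n !subrr normr0 mul0r.
  rewrite addSn; have := S_step (i + k)%N y.
  have := ler_distD (S (i + k)%N y) (S (i + k).+1 y) (S k y).
  by move: IHi; rewrite !mulrBl; lra.
have S_dist' k m y : (k <= m)%N -> `|S m y - S k y| <= r ^+ k * (`|y| / 4).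
  move=> /(S_dist k m y) /le_trans; apply; rewrite mulrBl gerDl oppr_le0.
  by rewrite mulr_ge0// ltW.
have S_cvg y : cvgn (S ^~ y).
  have r_cvg : r ^+ n * (`|y| / 4) @[n --> \oo] --> (0 : R).
    rewrite -[X in _ --> X](mul0r (`|y| / 4)); apply: cvgMl; apply: cvg_expr.
    by rewrite ger0_norm /r; lra.
  (* By the telescoped bound, subtracting the vanishing error term makes the sequence nondecreasing,
     and it is bounded above. *)
  have mono_cvg : cvgn (fun n => S n y - r ^+ n * (`|y| / 4)).
    apply: nondecreasing_is_cvgn.
      move=> k m /= /(S_dist k m y); rewrite ler_norml => /andP[+ _].
      by rewrite mulrBl; lra.
    exists (S 0%N y + `|y| / 4) => _ [k _ <-].
    have := S_dist' 0%N k y (leq0n k); rewrite ler_norml => /andP[_].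
    have : 0 <= r ^+ k * (`|y| / 4) by rewrite mulr_ge0// ltW.
    by rewrite expr0; lra.
  have : cvgn (fun n => (S n y - r ^+ n * (`|y| / 4)) + r ^+ n * (`|y| / 4)).
    by apply: is_cvgD => //; apply/cvg_ex; exists 0.
  by under eq_fun do rewrite subrK.
pose phi y := limn (S ^~ y).
have phi_dist k y : `|phi y - S k y| <= r ^+ k * (`|y| / 4).
  have : `|S n y - S k y| @[n --> \oo] --> `|phi y - S k y|.
    by apply: cvg_norm; apply: cvgB; [exact: S_cvg|exact: cvg_cst].
  move/cvgr_to_le; apply; exists k => // n /= kn; exact: S_dist'.
have phi_bnd : bounded_functional 3 phi.
  split=> [a y w|y].
    apply: cvg_lim => //; under eq_fun do rewrite S_lin.
    by apply: cvgD; [apply: cvgMr|]; exact: S_cvg.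
  have := phi_dist 0%N y; have [_ /(_ y) /=] := psi_bnd 0%N.
  rewrite expr0 mul1r; have := ler_normD (phi y - psi 0%N y) (psi 0%N y).
  by rewrite subrK; have := normr_ge0 y; lra.
have phi_z k : k%:R <= `|phi (z k)|.
  apply: (@le_trans _ _ (r ^+ k * (`|z k| / 4))).
    rewrite /r exprVn mulrC ler_pdivlMr ?exprn_gt0//.
    by have := z_large k; lra.
  have := phi_dist k (z k); have := S_z k.
  have := ler_distD (phi (z k)) (S k (z k)) 0; rewrite !subr0 distrC.
  by lra.
have /cvgP/cvg_seq_bounded[M [_ /(_ (M + 1))]] :=
  weak_cvg_bounded_functional phi_bnd ux.
rewrite ltrDl => /(_ ltr01) uM.
have := archi_boundP (normr_ge0 (M + 1)).
rewrite ltNge (le_trans (phi_z _))// (le_trans _ (ler_norm _))//.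
exact: uM.
Qed.

End BoundedFunctional.

Lemma norm_normalized (R : realType) (V : normedModType R) (x : V) :
  x != 0 -> `|(`|x|^-1 *: x)| = 1.
Proof.
by move=> x0; rewrite normrZ ger0_norm ?invr_ge0// mulVf// normr_eq0.
Qed.

(** * Norming functionals and weak convergence in l_p *)

Section EllWeak.
Variables (R : realType) (p : R) (p1 : 1 <= p).
Implicit Types x y : ell p1.

Let p0 : 0 < p. Proof. exact: lt_le_trans p1. Qed.

(** The duality functional [w |-> \sum_k sg (v k) |v k|^(p-1) w k] of the normalized vector [v], cut
    off where half of the norm of [v] is reached. The elementary bound [a^(p-1) b <= a^p + b^p]
    stands in for the Hölder inequality and costs the factor 2. *)
Lemma ell_norming x : exists2 phi : ell p1 -> R,
  bounded_functional 2 phi & `|x| / 2 <= `|phi x|.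
Proof.
have [->|x0] := eqVneq x 0.
  exists (fun=> 0); last by rewrite !normr0 mul0r.
  by split=> [a y z|y]; rewrite ?mulr0 ?addr0// normr0 mulr_ge0.
have nx0 : 0 < `|x| by rewrite normr_gt0.
pose v : ell p1 := `|x|^-1 *: x.
have v1 : `|v| = 1 by exact: norm_normalized.
have [N vN] : exists N, 1 / 2 <= \sum_(k < N) `|v k| `^ p.
  have half0 : 0 < 1 / 2 :> R by lra.
  have [N _ /(_ N (leqnn N)) /= vN] := psum_ell_norm_approx v half0.
  by exists N; move: vN; rewrite v1 powR1; lra.
pose c k : R := Num.sg (v k) * `|v k| `^ (p - 1).
pose phi (w : ell p1) := \sum_(k < N) c k * w k.
have phi_lin a y w : phi (a *: y + w) = a * phi y + phi w.
  rewrite /phi mulr_sumr -big_split; apply: eq_bigr => k _.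
  by rewrite ellDE ellZE mulrDr mulrCA.
have phiZ a y : phi (a *: y) = a * phi y.
  have phi00 : phi 0 = 0 by rewrite /phi big1// => k _; rewrite ell0E mulr0.
  by have := phi_lin a y 0; rewrite addr0 phi00 addr0.
have c_le k b : 0 <= b -> `|c k| * b <= `|v k| `^ p + b `^ p.
  move=> b0.
  have ck : `|c k| <= `|v k| `^ (p - 1).
    rewrite normrM (ger0_norm (powR_ge0 _ _)) ler_piMl ?powR_ge0//.
    by rewrite normr_sg; case: (_ != _).
  apply: (le_trans (ler_wpM2r b0 ck)).
  have pB0 : 0 <= p - 1 by rewrite subr_ge0.
  (* The product is at most the [p]-th power of the larger of the two numbers. *)
  have [bv|/ltW vb] := leP b `|v k|.
    apply: (@le_trans _ _ (`|v k| `^ p)); last by rewrite lerDl powR_ge0.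
    by rewrite -[leRHS]mulr_powRB1// mulrC ler_wpM2r ?powR_ge0.
  apply: (@le_trans _ _ (b `^ p)); last by rewrite lerDr powR_ge0.
  by rewrite -[leRHS]mulr_powRB1// mulrC ler_wpM2l// ge0_ler_powR ?nnegrE.
have phi_bnd y : `|phi y| <= 2 * `|y|.
  have [->|y0] := eqVneq y 0.
    by rewrite /phi big1 ?normr0 ?mulr0// => k _; rewrite ell0E mulr0.
  have ny0 : 0 < `|y| by rewrite normr_gt0.
  pose w : ell p1 := `|y|^-1 *: y.
  have w1 : `|w| = 1 by exact: norm_normalized.
  have -> : phi y = `|y| * phi w by rewrite phiZ mulrA mulfV ?mul1r// gt_eqF.
  rewrite normrM normr_id mulrC ler_wpM2r//.
  rewrite (le_trans (ler_norm_sum _ _ _))//.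
  apply: (@le_trans _ _ (\sum_(k < N) (`|v k| `^ p + `|w k| `^ p))).
    by apply: ler_sum => k _; rewrite normrM c_le.
  have := psum_le_ell_norm v N; have := psum_le_ell_norm w N.
  by rewrite v1 w1 powR1 big_split/=; lra.
exists phi; first by [].
have -> : phi x = `|x| * phi v by rewrite phiZ mulrA mulfV ?mul1r// gt_eqF.
rewrite normrM normr_id ler_wpM2l// (le_trans _ (ler_norm _))//.
rewrite (le_trans _ (le_trans vN _))//; first by rewrite mul1r.
apply: ler_sum => k _; rewrite /c mulrAC -normrEsg.
by rewrite mulr_powRB1.
Qed.

Lemma weak_cvg_ell_bounded u x : weak_cvg u x -> exists M, forall n, `|u n : ell p1| <= M.
Proof. by apply: weak_cvg_bounded; exact: ell_norming. Qed.

Lemma weak_cvg_ell_coord (u : nat -> ell p1) x k :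
  weak_cvg u x -> u n k @[n --> \oo] --> x k.
Proof.
apply: (@weak_cvg_bounded_functional _ _ 1 (fun y : ell p1 => y k)); split=> // y.
by rewrite mul1r; exact: ler_coord_ell_norm.
Qed.

End EllWeak.

(** * Gliding humps in l_q for q > 1 *)

Section GlidingHump.
Variables (R : realType) (q : R) (q1 : 1 <= q).
Variables (phi : {linear ell q1 -> R}) (M d : R) (v : nat -> ell q1).
Hypothesis q_gt1 : 1 < q.
Hypotheses (cphi : continuous phi) (v_bnd : forall n, `|v n| <= M) (d0 : 0 < d).
Hypothesis v_coord : forall k, v n k @[n --> \oo] --> (0 : R).
Hypothesis v_large : forall m, exists2 n, (m <= n)%N & d <= phi (v n).

Let q0 : 0 < q. Proof. exact: lt_le_trans q1. Qed.

Local Notation b := (fun k => phi (ell_basis q1 k)).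

Let phi_comb (a : nat -> R) N :
  phi (\sum_(k < N) a k *: ell_basis q1 k) = \sum_(k < N) a k * b k.
Proof. by rewrite linear_sum; apply: eq_bigr => k _; rewrite linearZ. Qed.

(** Coordinatewise convergence makes the part of some [v n] before [N] cost at most [d / 4] under
    [phi], and convergence of the truncations makes the part after [N'] cost at most [d / 4]; the
    block between keeps half of [d]. *)
Let hump N : exists N' (a : nat -> R),
  [/\ (N <= N')%N, \sum_(N <= k < N') `|a k| `^ q <= M `^ q &
      d / 2 <= \sum_(N <= k < N') a k * b k].
Proof.
have head0 : \sum_(k < N) v n k * b k @[n --> \oo] --> (0 : R).
  elim: N => [|N IHN].
    by under eq_fun do rewrite big_ord0; exact: cvg_cst.
  have last0 : v n N * b N @[n --> \oo] --> (0 : R).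
    by rewrite -[X in _ --> X](mul0r (b N)); apply: cvgMl; exact: v_coord.
  have -> : (fun n => \sum_(k < N.+1) v n k * b k) =
      (fun n => \sum_(k < N) v n k * b k + v n N * b N).
    by apply/funext => n; rewrite big_ord_recr.
  by have := cvgD IHN last0; rewrite addr0; apply.
have d4 : 0 < d / 4 by rewrite divr_gt0.
move/cvgrPdist_le: head0 => /(_ _ d4)[m _ head_small].
have [n mn dn] := v_large m.
have : phi (\sum_(k < N') v n k *: ell_basis q1 k) @[N' --> \oo] --> phi (v n).
  by apply: continuous_cvg; [exact: cphi|exact: ell_comb_cvg].
move/cvgrPdist_le => /(_ _ d4)[m' _ tail_small].
exists (maxn N m'), (v n); split; first exact: leq_maxl.
  have M0 : 0 <= M by rewrite (le_trans _ (v_bnd 0%N)).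
  apply: (@le_trans _ _ (`|v n| `^ q)); last first.
    by rewrite ge0_ler_powR ?nnegrE ?(ltW q0).
  apply: le_trans (psum_le_ell_norm _ (maxn N m')).
  rewrite -(big_mkord xpredT (fun k => `|v n k| `^ q)).
  by rewrite [leRHS](big_cat_nat _ (leq_maxl N m'))//= lerDr sumr_ge0.
have tl := tail_small (maxn N m') (leq_maxr _ _); rewrite /= phi_comb in tl.
have hd := head_small n mn; rewrite /= sub0r normrN in hd.
move: tl hd.
rewrite -(big_mkord xpredT (fun k => v n k * b k)).
rewrite -(big_mkord xpredT (fun k => v n k * b k)).
rewrite (big_cat_nat _ (leq_maxl N m'))//=.
by rewrite !ler_norml => /andP[? ?] /andP[? ?]; lra.
Qed.

(** Over consecutive disjoint blocks both the [q]-th powers of the norms and the values of [phi] add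
    up. *)
Let humps m : exists N (a : nat -> R),
  \sum_(k < N) `|a k| `^ q <= m%:R * M `^ q /\
  m%:R * (d / 2) <= \sum_(k < N) a k * b k.
Proof.
elim: m => [|m [N [a [a_norm a_phi]]]].
  by exists 0%N, (fun=> 0); rewrite !big_ord0 !mul0r.
have [N' [a' [NN' a'_norm a'_phi]]] := hump N.
exists N', (fun k => if (k < N)%N then a k else a' k).
have split_sum (F : nat -> R -> R) :
    \sum_(k < N') F k (if (k < N)%N then a k else a' k) =
    \sum_(k < N) F k (a k) + \sum_(N <= k < N') F k (a' k).
  rewrite -(big_mkord xpredT (fun k => F k (if (k < N)%N then a k else a' k))).
  rewrite (big_cat_nat _ NN')//=; congr (_ + _).
    by rewrite big_mkord; apply: eq_bigr => k _; rewrite ltn_ord.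
  by apply: eq_big_nat => k /andP[Nk _]; rewrite ltnNge Nk.
rewrite (split_sum (fun=> fun t => `|t| `^ q)) (split_sum (fun k t => t * b k)).
by rewrite -natr1 !mulrDl !mul1r !lerD.
Qed.

Lemma no_gliding_hump : False.
Proof.
have [C C0 leC] := continuous_linear_bound cphi.
have M0 : 0 <= M by rewrite (le_trans _ (v_bnd 0%N)).
have key (m : nat) : m%:R * (d / 2) <= C * (m%:R `^ q^-1 * M).
  have [N [a [a_norm a_phi]]] := humps m.
  apply: (le_trans a_phi); rewrite -phi_comb (le_trans (ler_norm _))//.
  rewrite (le_trans (leC _))// ler_wpM2l ?(ltW C0)//.
  apply: ell_norm_comb_le; first by rewrite mulr_ge0 ?powR_ge0.
  by rewrite powRM ?powR_ge0// -powRrM mulVf ?gt_eqF// powRr1.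
(* Dividing by [m^(1/q)] leaves a positive power of [m], which cannot stay bounded since [q > 1]. *)
have key' (m : nat) : (m.+1%:R : R) `^ (1 - q^-1) <= C * M / (d / 2).
  have m0 : 0 < m.+1%:R :> R by rewrite ltr0n.
  rewrite powRB; last by rewrite (gt_eqF m0) implybT.
  rewrite powRr1 ?(ltW m0)// ler_pdivrMr ?powR_gt0//.
  rewrite mulrAC ler_pdivlMr ?divr_gt0//.
  by rewrite (le_trans (key m.+1))// mulrA mulrAC.
have qV : 0 < 1 - q^-1 by rewrite subr_gt0 invf_lt1.
set K := C * M / (d / 2) in key'.
have K0 : 0 <= K by rewrite /K divr_ge0 ?mulr_ge0 ?(ltW C0)// ltW// divr_gt0.
have := archi_boundP (powR_ge0 K (1 - q^-1)^-1).
set m := Num.bound _ => Km.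
have := key' m; apply/negP; rewrite -ltNge.
have {}Km : K `^ (1 - q^-1)^-1 < m.+1%:R by rewrite (lt_le_trans Km)// ler_nat.
have := gt0_ltr_powR qV _ _ Km; rewrite !nnegrE powR_ge0 ler0n => /(_ isT isT).
by rewrite -powRrM mulVf ?gt_eqF// powRr1.
Qed.

End GlidingHump.

Lemma bounded_coord_weak_cvg (R : realType) (q : R) (q1 : 1 <= q)
    (u : nat -> ell q1) (x : ell q1) (M : R) : 1 < q ->
  (forall n, `|u n| <= M) -> (forall k, u n k @[n --> \oo] --> x k) ->
  weak_cvg u x.
Proof.
move=> q_gt1 uM ux phi cphi.
(* The hump argument is one-sided, so it is applied to [u n - x] and to its opposite. If the bound
   is not eventually true, the value [e] is reached for arbitrarily large [n]. *)
have small (s : R) : `|s| = 1 -> forall e, 0 < e ->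
    \forall n \near \oo, phi (s *: (u n - x)) < e.
  move=> s1 e e0.
  have [//|nlt] := pselect (\forall n \near \oo, phi (s *: (u n - x)) < e).
  exfalso; apply: (@no_gliding_hump R q q1 phi (M + `|x|) e
    (fun n => s *: (u n - x))) => // [n|k|m].
  - by rewrite normrZ s1 mul1r (le_trans (ler_normB _ _))// lerD2r.
  - rewrite -[X in _ --> X](mulr0 s) -[X in s * X](subrr (x k)).
    apply: cvgMr; apply: cvgB; last exact: cvg_cst.
    exact: ux.
  - have [//|no] := pselect (exists2 n, (m <= n)%N & e <= phi (s *: (u n - x))).
    exfalso; apply: nlt; exists m => // n mn /=.
    by rewrite ltNge; apply/negP => ?; apply: no; exists n.
apply/cvgrPdist_lt => e e0.
have pos := small 1 (normr1 _) e e0.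
have neg := small (-1) (etrans (normrN _) (normr1 _)) e e0.
near=> n; rewrite distrC ltr_norml -raddfB; apply/andP; split.
  by rewrite -ltrNl -raddfN -scaleN1r; near: n.
by rewrite -[u n - x]scale1r; near: n.
Unshelve. all: by end_near. Qed.

(** * Isomorphic embeddings *)

Lemma snow_ell_weakly_sequentially_continuous (R : realType) (p q : R)
    (p1 : 1 <= p) (q1 : 1 <= q) (pq : p < q) :
  weakly_sequentially_continuous (@snow_ell R p q p1 q1 pq).
Proof.
move=> u x ux; set f := snow_ell q1 pq.
have [M uM] := weak_cvg_ell_bounded ux.
have [[/(_ `|M| (normr_ge0 _)) expM _] _] := strong_embedding_snow_ell p1 q1 pq.
(* A coarse embedding maps bounded sequences to bounded ones: the finite expansion at [|M|] controls
   the distance to [f 0]. *)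
have exp_ge n : (`|f (u n) - f 0|%:E <= expansion f `|M|)%E.
  apply: ereal_sup_ubound; exists (u n), 0; split=> //.
  by rewrite subr0 (le_trans (uM n))// ler_norm.
apply: (@bounded_coord_weak_cvg _ _ _ _ _ (fine (expansion f `|M|) + `|f 0|)).
- exact: (le_lt_trans p1 pq).
- move=> n; rewrite -[X in `|X|](subrK (f 0)) (le_trans (ler_normD _ _))// lerD2r.
  by have := exp_ge n; move: expM; rewrite -/f; case: (expansion f _).
- move=> k; rewrite /= snow_ellE /snow_seq.
  have -> : (fun n => f (u n) k) = (fun n => snow_seq q (u n) k).
    by apply/funext => n; rewrite /f snow_ellE.
  rewrite /snow_seq; case: pickle_inv => [[i j]|] /=; last exact: cvg_cst.
  apply: continuous_cvg; first exact: continuous_snow.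
  exact: weak_cvg_ell_coord.
Qed.

Section IsomorphicEmbedding.
Variables (R : realType) (X Y : completeNormedModType R).
Implicit Type T : {linear X -> Y}.

(** Continuity of the inverse at 0 gives a radius [d] within which images come from the unit ball;
    rescaling [x] so that its image has norm [d / 2] yields the constant [d / 2]. *)
Lemma isomorphic_embedding_lower_bound T : isomorphic_embedding T ->
  exists2 c : R, 0 < c & forall x, c * `|x| <= `|T x|.
Proof.
move=> [_ [S [TS /subspace_continuousP cS]]].
have S0 : S 0 = 0 by rewrite -(linear0 T) TS.
have range0 : range T 0 by exists 0 => //; exact: linear0.
have cS0 : S y @[y --> within (range T) (nbhs (0 : Y))] --> (0 : X).
  by rewrite -[X in _ --> X]S0; exact: cS.
move: cS0 => /cvgrPdist_lt/(_ 1 ltr01); rewrite near_withinE => /nbhs_ballP[d /= d0 dS].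
exists (d / 2) => [|x]; first by rewrite divr_gt0.
have [Tx0|Tx0] := eqVneq (T x) 0.
  by rewrite -(TS x) Tx0 S0 normr0 mulr0.
have nTx : 0 < `|T x| by rewrite normr_gt0.
pose s := d / 2 / `|T x|.
have s0 : 0 < s by rewrite !divr_gt0.
have /= := dS (T (s *: x)); rewrite TS sub0r normrN normrZ gtr0_norm//.
have in_ball : ball 0 d (T (s *: x)).
  rewrite -ball_normE /= sub0r normrN linearZ normrZ gtr0_norm//.
  by rewrite /s divfK ?gt_eqF// ltr_pdivrMr// ltr_pMr// ltr1n.
move=> /(_ in_ball (ex_intro2 _ _ (s *: x) I erefl)) /ltW.
by rewrite /s mulrAC ler_pdivrMr// mul1r.
Qed.

Lemma isomorphic_embedding_strong T : isomorphic_embedding T ->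
  strong_embedding T.
Proof.
move=> iT; have [c c0 lec] := isomorphic_embedding_lower_bound iT.
have [C C0 leC] := continuous_linear_bound iT.1.
apply: (@strong_embedding_of_bounds _ _ _ _ c 1 ( *%R C)) => //.
- by move=> x y; rewrite powRr1// -linearB.
- by move=> s t _ _ st; rewrite ler_pM2l.
- rewrite -[X in _ --> X](mulr0 C); apply: cvgMr.
  exact: cvg_within.
- by move=> x y; rewrite -linearB.
Qed.

Lemma continuous_linear_weakly_sequentially_continuous T :
  continuous T -> weakly_sequentially_continuous T.
Proof.
move=> cT u x ux phi cphi.
exact: (ux (phi \o T) (fun y => continuous_comp (cT y) (cphi (T y)))).
Qed.

End IsomorphicEmbedding.

(** * Non-embeddability of l_1 into l_2 *)

Section EllOneTwo.
Variables (R : realType) (one1 : 1 <= (1 : R)) (one2 : 1 <= (2 : R)).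

Lemma ell2_parallelogram (x y : ell one2) :
  `|x + y| ^+ 2 + `|x - y| ^+ 2 = 2 * `|x| ^+ 2 + 2 * `|y| ^+ 2.
Proof.
apply: EFin_inj; rewrite -!powR_mulrn// !EFinD !EFinM !ell_norm_powR.
rewrite -!nneseriesZl// -!nneseriesD//; apply: eq_eseriesr => k _.
rewrite -!EFinM -!EFinD !powR_mulrn// !real_normK ?num_real// ellDE ellBE.
by congr EFin; ring.
Qed.

(** By the parallelogram identity [|s + y|^2] and [|s - y|^2] average to [|s|^2 + |y|^2], so at each
    step one sign does not exceed it. *)
Lemma ell2_signs (y : nat -> ell one2) n : exists2 e : nat -> R,
  forall k, `|e k| = 1 &
  `|\sum_(k < n) e k *: y k| ^+ 2 <= \sum_(k < n) `|y k| ^+ 2.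
Proof.
elim: n => [|n [e e1 ele]].
  by exists (fun=> 1) => [k|]; rewrite ?normr1// !big_ord0 normr0 expr0n.
pose s := \sum_(k < n) e k *: y k.
have [b b1 ble] : exists2 b : R, `|b| = 1 &
    `|s + b *: y n| ^+ 2 <= `|s| ^+ 2 + `|y n| ^+ 2.
  have := ell2_parallelogram s (y n).
  have [le1 _|lt1 E] := leP (`|s + y n| ^+ 2) (`|s| ^+ 2 + `|y n| ^+ 2).
    by exists 1; rewrite ?normr1 ?scale1r.
  by exists (-1); rewrite ?normrN ?normr1 ?scaleN1r//; move: lt1 E; lra.
exists (fun k => if k == n then b else e k) => [k|]; first by case: eqP.
rewrite !big_ord_recr/= eqxx (_ : \sum_(k < n) _ = s); last first.
  by apply: eq_bigr => k _; rewrite ltn_eqF.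
by rewrite (le_trans ble)// lerD2r.
Qed.

Lemma ell1_not_isomorphically_embeds_ell2 :
  ~ isomorphically_embeds (ell one1) (ell one2).
Proof.
move=> [T iT]; have [c c0 lec] := isomorphic_embedding_lower_bound iT.
have [C C0 leC] := continuous_linear_bound iT.1.
have basis_le k : `|ell_basis one1 k| <= 1.
  have -> : ell_basis one1 k = \sum_(i < k.+1) (i == k :> nat)%:R *: ell_basis one1 i.
    rewrite big_ord_recr/= eqxx scale1r big1 ?add0r// => i _.
    by rewrite ltn_eqF ?scale0r.
  apply: (@ell_norm_comb_le _ _ _ (fun i => (i == k)%:R)) => //.
  rewrite big_ord_recr/= big1 ?add0r.
    by rewrite eqxx normr1 powRr1.
  by move=> i _; rewrite ltn_eqF ?normr0 ?powRr1.
(* A signed sum of [n] unit vectors has norm at least [n], while its image has squared norm at most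
   [n * C^2]; thus [(c n)^2 <= n C^2], which fails for large [n]. *)
have key (n : nat) : c ^+ 2 * n%:R <= C ^+ 2.
  have [->|n0] := eqVneq n 0%N; first by rewrite mulr0 sqr_ge0.
  have [e e1 ele] := ell2_signs (fun k => T (ell_basis one1 k)) n.
  pose x := \sum_(k < n) e k *: ell_basis one1 k.
  have nx : n%:R <= `|x|.
    have := psum_le_ell_norm x n; rewrite powRr1//; apply: le_trans.
    rewrite (eq_bigr (fun=> 1)) ?sumr_const ?card_ord// => k _.
    by rewrite ell_combE ltn_ord e1 powRr1.
  have Tx : `|T x| ^+ 2 <= n%:R * C ^+ 2.
    rewrite linear_sum; under eq_bigr do rewrite linearZ.
    apply: (le_trans ele); rewrite mulr_natl -[n in leRHS]card_ord -sumr_const.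
    apply: ler_sum => k _; rewrite ler_pXn2r ?nnegrE ?(ltW C0)//.
    by rewrite (le_trans (leC _))// ler_piMr ?(ltW C0).
  have nR : 0 < n%:R :> R by rewrite ltr0n lt0n.
  have le_Tx : c * n%:R <= `|T x|.
    by rewrite (le_trans _ (lec x))// ler_pM2l.
  have : (c * n%:R) ^+ 2 <= `|T x| ^+ 2.
    by rewrite ler_pXn2r ?nnegrE// mulr_ge0 ?ltW.
  move=> /le_trans/(_ Tx); rewrite exprMn mulrC expr2 -mulrA ler_pM2l//.
  by rewrite mulrC.
have c2 : 0 < c ^+ 2 by rewrite exprn_gt0.
have := archi_boundP (divr_ge0 (sqr_ge0 C) (ltW c2)).
by rewrite ltNge ler_pdivlMr// mulrC key.
Qed.

End EllOneTwo.

Theorem theorem1p8 (R : realType) :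
  (forall (p q : R) (p1 : 1 <= p) (q1 : 1 <= q), p < q ->
     exists f : ell p1 -> ell q1,
       strong_embedding f /\ weakly_sequentially_continuous f) /\
  (forall X Y : completeNormedModType R, isomorphically_embeds X Y ->
     (exists f : X -> Y,
        coarse_embedding f /\ weakly_sequentially_continuous f) /\
     (exists f : X -> Y,
        uniform_embedding f /\ weakly_sequentially_continuous f)) /\
  (exists X Y : completeNormedModType R,
     (exists f : X -> Y,
        coarse_embedding f /\ weakly_sequentially_continuous f) /\
     ~ isomorphically_embeds X Y) /\
  (exists X Y : completeNormedModType R,
     (exists f : X -> Y,
        uniform_embedding f /\ weakly_sequentially_continuous f) /\
     ~ isomorphically_embeds X Y).
Proof.
have strong (p q : R) (p1 : 1 <= p) (q1 : 1 <= q) : p < q ->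
    exists f : ell p1 -> ell q1,
      strong_embedding f /\ weakly_sequentially_continuous f.
  move=> pq; exists (@snow_ell _ _ _ p1 q1 pq); split.
    exact: strong_embedding_snow_ell.
  exact: snow_ell_weakly_sequentially_continuous.
have one1 : 1 <= (1 : R) by [].
have one2 : 1 <= (2 : R) by rewrite ler1n.
(* The pair [l_1], [l_2] with one and the same map witnesses both the coarse and the uniform
   claim. *)
have [f [[coarse_f uniform_f] wsc_f]] := strong _ _ one1 one2 (ltr1n R 2).
have not_emb : ~ isomorphically_embeds (ell one1) (ell one2).
  exact: ell1_not_isomorphically_embeds_ell2.
split; first exact: strong.
split=> [X Y [T iT]|].
  have [coarse_T uniform_T] := isomorphic_embedding_strong iT.
  have wsc_T := continuous_linear_weakly_sequentially_continuous iT.1.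
  by split; exists T.
by split; exists (ell one1), (ell one2); split=> //; exists f.
Qed.
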